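(* Let $(\mathrm D)$ be a projectively singular system of degree $n$, let $a\in\mathbb{R}$ with $X_n(1,a)=0$, and let $A$ be the infinitely removed point lying on the ''extremities'' of the straight line $y=ax$. If in addition (a) $W_{n-1}(1,a)\,\partial_yX_n(1,a)<0$; or (b) $W_{n-1}(1,a)\,\partial_yX_n(1,a)>0$; or (c) $\partial_yX_n(1,a)=0$ and $W_{n-1}(1,a)\,\partial_{yy}X_n(1,a)\neq0$, then the equatorial contact $A$-trajectory of $(\mathrm D)$ in a sufficiently small neighbourhood of $A$ is located (apart from the point $A$ itself), respectively: (a) in the half-plane $x>0$; (b) in the half-plane $x<0$; (c) both in the half-plane $x>0$ and in the half-plane $x<0$ (passing from one to the other through $A$).
   Context: System $(\mathrm D)$ of degree $n$: $\frac{dx}{dt}=X(x,y)=\sum_{k=0}^n X_k(x,y)$, $\frac{dy}{dt}=Y(x,y)=\sum_{k=0}^n Y_k(x,y)$, where $X_k,Y_k$ are real homogeneous polynomials of degree $k$, $X_n$ and $Y_n$ are not both identically zero, and $X,Y$ are relatively prime (no common divisors other than real numbers). Put $W_i(x,y)=xY_i(x,y)-yX_i(x,y)$, $i=0,\dots,n$. The system is projectively singular if $W_n\equiv 0$ on $\mathbb{R}^2$ (this forces $n\ge1$). The projective phase plane $\mathbb{RP}(x,y)$ is the plane $(x,y)$ completed by the line at infinity, with charts $(x,y)$, $(\xi,\theta)=(\frac yx,\frac1x)$, $(\eta,\zeta)=(\frac1y,\frac xy)$. For a projectively singular system the trajectories in the chart $(\xi,\theta)$ are those of the first projectively reduced system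 $$\frac{d\xi}{d\tau}=\sum_{j=0}^{n-1}\theta^{n-j-1}W_j(1,\xi),\qquad \frac{d\theta}{d\tau}=-\sum_{i=0}^n\theta^{n-i}X_i(1,\xi).$$ The point at infinity on the ''extremities'' of the line $y=ax$ is the point at infinity of this line, i.e. $(\xi,\theta)=(a,0)$. An equatorial contact point is a point of the line at infinity, not an equilibrium, at which the trajectory on $\mathbb{RP}(x,y)$ is tangent to the line at infinity; the equatorial contact $A$-trajectory is the trajectory on $\mathbb{RP}(x,y)$ passing through the equatorial contact point $A$. *)

(* Defs.v *)
(* MathComp / MathComp-Analysis, over an arbitrary [R : realType]. *)
From HB Require Import structures.
From mathcomp Require Import all_boot all_order all_algebra.
(* The notations of [mpoly] are incompatible with those of MathComp-Analysis. *)
From mathcomp Require Import -(notations) mpoly.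
From mathcomp Require Import all_classical all_reals all_analysis.

Set Implicit Arguments.
Unset Strict Implicit.
Unset Printing Implicit Defensive.

Import Order.TTheory GRing.Theory Num.Theory.
Import numFieldNormedType.Exports.

Local Open Scope classical_set_scope.
Local Open Scope ring_scope.

Section System.
Variable R : realType.

(* R[x, y]: the variable of index 0 is x, the variable of index 1 is y. *)
Definition bipoly := mpoly 2 R.

Definition ix : 'I_2 := ord0.
Definition iy : 'I_2 := ord_max.
Definition varx : bipoly := mpolyX R (mnm1 ix).
Definition vary : bipoly := mpolyX R (mnm1 iy).

Definition peval (p : bipoly) (x y : R) : R :=
  meval (fun i : 'I_2 => if i == ix then x else y) p.

Definition partial_y (p : bipoly) : bipoly := mderiv iy p.

Definition bipoly_divides (d p : bipoly) : Prop := exists q : bipoly, p = d * q.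

Definition relatively_prime (p q : bipoly) : Prop :=
  forall d : bipoly, bipoly_divides d p -> bipoly_divides d q ->
    exists c : R, d = mpolyC 2 c.

(* Only the components [X k] and [Y k] with [k <= n] are meaningful. *)
Record is_system (n : nat) (X Y : nat -> bipoly) : Prop := IsSystem {
  homogX : forall k : nat, (k <= n)%N -> X k \is ishomog1 k (@mdeg 2);
  homogY : forall k : nat, (k <= n)%N -> Y k \is ishomog1 k (@mdeg 2);
  top_neq0 : ~ (X n = 0 /\ Y n = 0);
  coprimeXY : relatively_prime (\sum_(k < n.+1) X k) (\sum_(k < n.+1) Y k)
}.

Variables (n : nat) (X Y : nat -> bipoly).

Definition W (i : nat) : bipoly := varx * Y i - vary * X i.

Definition projectively_singular : Prop :=
  forall x y : R, peval (W n) x y = 0.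

(* The points of the chart (xi, theta) = (y/x, 1/x) of the projective phase
   plane are the pairs [p] with [p.1 = xi] and [p.2 = theta]; the line at
   infinity is [p.2 = 0] there. *)
Definition first_chart (q : R * R) : R * R := (q.2 / q.1, q.1^-1).

Definition right_half_plane : set (R * R) :=
  first_chart @` [set q : R * R | 0 < q.1].

Definition left_half_plane : set (R * R) :=
  first_chart @` [set q : R * R | q.1 < 0].

(* The common point at infinity of the two ends of the line y = a x. *)
Definition infinite_point (a : R) : R * R := (a, 0).

(* The right-hand side of the first projectively reduced system of a
   projectively singular system; it is only used for such systems. *)
Definition reduced_field (p : R * R) : R * R :=
  (\sum_(j < n) p.2 ^+ (n - j - 1) * peval (W j) 1 p.1,
   - \sum_(i < n.+1) p.2 ^+ (n - i) * peval (X i) 1 p.1).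

(* A point of the line at infinity which is not an equilibrium and at which
   the velocity is parallel to the line at infinity. *)
Definition equatorial_contact_point (A : R * R) : Prop :=
  [/\ A.2 = 0, reduced_field A <> (0, 0) & (reduced_field A).2 = 0].

(* [gamma], on the open interval ]alpha, beta[, is an arc of the trajectory
   through [A], passing through [A] at time [t0] and contained in [U]. *)
Definition trajectory_arc (U : set (R * R)) (A : R * R)
    (gamma : R -> R * R) (alpha t0 beta : R) : Prop :=
  [/\ alpha < t0 < beta,
      gamma t0 = A &
      forall t : R, alpha < t < beta ->
        [/\ U (gamma t),
            is_derive t (1 : R) (fun s => (gamma s).1) (reduced_field (gamma t)).1 &
            is_derive t (1 : R) (fun s => (gamma s).2) (reduced_field (gamma t)).2]].

(* In some neighbourhood of [A], the trajectory through [A] lies in [S1] before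
   reaching [A] and in [S2] after leaving [A]. The part of the trajectory in
   the neighbourhood [U] is the union of the arcs through [A] contained
   in [U]. *)
Definition trajectory_near (A : R * R) (S1 S2 : set (R * R)) : Prop :=
  exists2 U : set (R * R), nbhs A U &
    forall (gamma : R -> R * R) (alpha t0 beta : R),
      trajectory_arc U A gamma alpha t0 beta ->
      (forall t : R, alpha < t < t0 -> S1 (gamma t)) /\
      (forall t : R, t0 < t < beta -> S2 (gamma t)).

End System.

(* Main.v *)
Require Import Defs.
From mathcomp Require Import all_boot all_order all_algebra.
From mathcomp Require Import -(notations) mpoly.
From mathcomp Require Import all_classical all_reals all_analysis.
From mathcomp Require Import ring lra.

Set Implicit Arguments.
Unset Strict Implicit.
Unset Printing Implicit Defensive.

Import Order.TTheory GRing.Theory Num.Theory.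
Import numFieldNormedType.Exports.

Local Open Scope classical_set_scope.
Local Open Scope ring_scope.

(** Near the contact point [A = (a, 0)] the reduced system reads
    xi' = f(xi, theta), theta' = - P(xi) - theta h(xi, theta), with
    P(xi) = X_n(1, xi) and f(A) = w := W_(n-1)(1, a). As w <> 0, the coordinate
    xi is strictly monotone along an arc through [A], so it lies on opposite,
    known sides of [a] before and after [A]; the order of the zero [a] of P
    then gives the sign of - P(xi) there. The arc crosses theta = 0 at [A],
    and wherever theta does not have the sign of the forcing term
    - P(xi) (of its opposite, before [A]), the bounded term theta h cannot
    prevent the drift: a linear differential inequality
    ([gt0_linear_after]) gives theta a strict sign on each side of [A]
    ([side_of_arc], [trajectory_near_sides]). The sign of theta = 1/x tells the
    half-plane. At a simple zero of P the forcing term changes sign with time,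
    so theta keeps its sign through [A]; at a double zero the forcing term keeps
    its sign, so theta changes sign ([near_simple_root],
    [near_double_root]). *)

Section ProjectiveContact.
Variable R : realType.

(** * Linear differential inequalities *)

Lemma derive_gt0_left (v : R -> R) (c l r : R) :
  is_derive c (1 : R) v l -> 0 < l -> r < c -> exists2 s, r < s < c & v s < v c.
Proof.
move=> [dv vl] l0 rc.
have q_l : h^-1 *: (v (h *: 1 + c) - v c) @[h --> (0 : R)^'-] --> l.
  have q_l : h^-1 *: (v (h *: 1 + c) - v c) @[h --> (0 : R)^'] --> l.
    by rewrite -vl; exact: dv.
  apply: cvg_trans q_l; apply: cvg_app => P.
  by apply: (@filterS _ (nbhs (0 : R))) => h Ph h0; apply: Ph; rewrite lt_eqF.
have : \forall h \near (0 : R)^'-,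
    [/\ h < 0, r - c < h & 0 < h^-1 *: (v (h *: 1 + c) - v c)].
  near=> h; split.
  - by near: h; exact: nbhs_left_lt.
  - by near: h; apply: nbhs_left_gt; rewrite subr_lt0.
  - by near: h; apply: cvgr_gt q_l _ l0.
move=> /filter_ex[h [h0 rh]]; rewrite [_ *: 1]mulr1 [_ *: _]/GRing.scale /=.
move=> vh.
exists (h + c); first by apply/andP; split; lra.
by rewrite -subr_lt0 -(nmulr_rgt0 _ (x := h^-1)) ?invr_lt0.
Unshelve. all: by end_near. Qed.

(** A minimum of [v] on [[t0, t1]] that is <= 0 can be found away from [t0]
    when [v t1 <= 0], but the derivative is positive there, which
    [derive_gt0_left] forbids. *)
Lemma gt0_after (v dv : R -> R) (t0 t1 : R) : t0 < t1 ->
  (forall t, t0 <= t <= t1 -> is_derive t (1 : R) v (dv t)) ->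
  v t0 = 0 ->
  (forall t, t0 < t <= t1 -> v t <= 0 -> 0 < dv t) -> 0 < v t1.
Proof.
move=> t01 dvP v0 dv_gt0; rewrite ltNge; apply/negP => v1.
have [c] : exists2 c, c \in `[t0, t1]%R &
    forall t, t \in `[t0, t1]%R -> v c <= v t.
  apply: EVT_min; first exact: ltW.
  apply: derivable_within_continuous => t; rewrite in_itv /= => tt01.
  by case: (dvP t tt01).
rewrite in_itv /= => /andP[c0 c1] cmin.
(* If the minimum is at t0 it is 0, and then t1 is a minimum as well. *)
have [d [d0 d1 dmin]] : exists d, [/\ t0 < d, d <= t1 &
    forall t, t0 <= t <= t1 -> v d <= v t].
  have [c0'|] := ltP t0 c; first by exists c; split => // t ht; apply: cmin.
  move=> c0'; exists t1; split => // t ht.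
  have ct0 : c = t0 by apply: le_anti; rewrite c0'.
  have -> : v t1 = v c.
    apply: le_anti; apply/andP; split; first by rewrite ct0 v0.
    by apply: cmin; rewrite in_itv /= lexx ltW.
  exact: cmin.
have vd : v d <= 0 by apply: le_trans v1; apply: dmin; rewrite lexx ltW.
have [||s /andP[s0 s1]] := derive_gt0_left (dvP d _) _ d0.
- by rewrite ltW.
- by apply: dv_gt0; rewrite ?d0.
- by apply/negP; rewrite -leNgt dmin // ltW //= (le_trans (ltW s1)).
Qed.

(** The factor [expR (- M * t)] absorbs the linear term. *)
Lemma gt0_linear_after (M : R) (v dv : R -> R) (t0 t1 : R) : t0 < t1 ->
  (forall t, t0 <= t <= t1 -> is_derive t (1 : R) v (dv t)) ->
  v t0 = 0 ->
  (forall t, t0 < t <= t1 -> v t <= 0 -> M * v t < dv t) -> 0 < v t1.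
Proof.
move=> t01 dvP v0 dv_gt.
pose g t := expR (- M * t) * (dv t - M * v t).
have : 0 < expR (- M * t1) * v t1.
  apply: (@gt0_after (fun t => expR (- M * t) * v t) g t0 t1) => //.
  - move=> t /dvP dvt.
    have dE : is_derive t (1 : R) (fun s => expR (- M * s))
        (expR (- M * t) * (- M)).
      apply: is_derive1_comp.
      by apply: is_derive_eq; rewrite [_ *: _]mulr1.
    apply: is_derive_eq; rewrite /g /GRing.scale /=; ring.
  - by rewrite v0 mulr0.
  - move=> t ht; rewrite pmulr_rle0 ?expR_gt0 // => vt.
    by rewrite /g pmulr_rgt0 ?expR_gt0 // subr_gt0 dv_gt.
by rewrite pmulr_rgt0 ?expR_gt0.
Qed.

(** * The side of an arc through the contact point *)

(** The sign [d] is the direction of time: the substitution t = t0 + d u, with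
    u >= 0, treats departure from and arrival at (a, 0) at once. The comparison
    lemma is used twice, first for d w (xi - a), whose derivative is
    w f > 0, then for s theta, whose derivative is s d (- P) - d h (s theta),
    at least s d (- P) + M (s theta) where s theta <= 0. *)
Lemma side_of_arc (U : set (R * R)) (f h : R * R -> R) (P : R -> R)
    (a w M s d : R) (gamma : R -> R * R) (alpha t0 beta : R) :
  d * d = 1 ->
  (forall p, U p -> [/\ 0 < w * f p, `|h p| <= M &
     0 < d * (w * (p.1 - a)) -> 0 < s * d * - P p.1]) ->
  alpha < t0 < beta -> gamma t0 = (a, 0) ->
  (forall t, alpha < t < beta ->
    [/\ U (gamma t),
        is_derive t (1 : R) (fun u => (gamma u).1) (f (gamma t)) &
        is_derive t (1 : R) (fun u => (gamma u).2)
          (- P (gamma t).1 - (gamma t).2 * h (gamma t))]) ->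
  forall t, alpha < t < beta -> 0 < d * (t - t0) -> 0 < s * (gamma t).2.
Proof.
move=> dd UP /andP[at0 t0b] g0 arc t /andP[a_t tb] dt.
pose tau u := t0 + d * u.
have tau_in u : 0 <= u <= d * (t - t0) -> alpha < tau u < beta.
  have := sqrf_eq1 d; rewrite expr2 dd eqxx => /esym/orP[]/eqP dE;
    rewrite /tau; move: dt; rewrite dE => dt /andP[u0 ut];
    apply/andP; split; lra.
have dtau u : is_derive u (1 : R) tau d.
  by rewrite /tau; apply: is_derive_eq; rewrite /GRing.scale /=; ring.
have tauT : tau (d * (t - t0)) = t by rewrite /tau mulrA dd; ring.
have tau0 : tau 0 = t0 by rewrite /tau mulr0 addr0.
have xi_side u : 0 < u <= d * (t - t0) -> 0 < d * (w * ((gamma (tau u)).1 - a)).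
  move=> /andP[u0 ut].
  apply: (@gt0_after (fun u => d * (w * ((gamma (tau u)).1 - a)))
            (fun u => w * f (gamma (tau u))) 0 u) => //.
  - move=> r /andP[r0 ru].
    have [_ dg _] := arc _ (tau_in r (introT andP (conj r0 (le_trans ru ut)))).
    have dgt := @is_derive1_comp R _ tau r _ _ dg (dtau r).
    have {}dgt : is_derive r (1 : R) (fun u => (gamma (tau u)).1)
        (f (gamma (tau r)) * d).
      exact: dgt.
    apply: is_derive_eq; rewrite /GRing.scale /= -[RHS]mul1r -dd; ring.
  - by rewrite tau0 g0 subrr !mulr0.
  - move=> r /andP[r0 ru] _.
    have rT : 0 <= r <= d * (t - t0) by rewrite ltW //= (le_trans ru).
    by have [/UP[]] := arc _ (tau_in _ rT).
rewrite -tauT.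
apply: (@gt0_linear_after M (fun u => s * (gamma (tau u)).2)
   (fun u => s * ((- P (gamma (tau u)).1
                   - (gamma (tau u)).2 * h (gamma (tau u))) * d)) 0) => //.
- move=> r /tau_in/arc[_ _ dg].
  have dgt := @is_derive1_comp R _ tau r _ _ dg (dtau r).
  have {}dgt : is_derive r (1 : R) (fun u => (gamma (tau u)).2) _ := dgt.
  by apply: is_derive_eq; rewrite /GRing.scale /=; ring.
- by rewrite tau0 g0 mulr0.
- move=> r /[dup] r_in /xi_side xi_r v_le0.
  have rT : 0 <= r <= d * (t - t0) by move/andP: r_in => [/ltW -> ->].
  have [/UP[_ hM P_gt0] _ _] := arc _ (tau_in _ rT).
  have {}P_gt0 := P_gt0 xi_r.
  set q := gamma (tau r) in hM P_gt0 v_le0 *.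
  have dh : `|d * h q| <= M.
    suff -> : `|d * h q| = `|h q| by [].
    by rewrite normrM -[`|d|]sqrtr_sqr expr2 dd sqrtr1 mul1r.
  have : M * (s * q.2) <= - (d * h q) * (s * q.2).
    by rewrite ler_wnM2r //; move: dh; rewrite ler_norml; lra.
  suff -> : s * ((- P q.1 - q.2 * h q) * d) =
      s * d * - P q.1 - d * h q * (s * q.2) by lra.
  by ring.
Qed.

(** * The system at the line at infinity *)

(** Setting x to 1 and keeping y as the indeterminate turns derivatives in y
    into formal derivatives of a univariate polynomial. *)
Definition dehom (p : bipoly R) : {poly R} :=
  mmap (@polyC R) (fun i => if i == ix then 1 else 'X) p.

Lemma horner_dehom p x : (dehom p).[x] = peval p 1 x.
Proof.
rewrite /peval /meval /dehom /mmap horner_sum; apply: eq_bigr => m _.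
rewrite hornerM hornerC /mmap1 horner_prod; congr (_ * _).
apply: eq_bigr => i _; rewrite horner_exp.
by case: ifP; rewrite !hornerE.
Qed.

Lemma dehom_partial_y p : dehom (partial_y p) = (dehom p)^`().
Proof.
rewrite /dehom /partial_y.
elim/mpolyind: p => [|c m p _ _ IHp]; first by rewrite !raddf0.
rewrite !raddfD /= IHp; congr (_ + _).
rewrite mderivZ !mmapZ !mderivX mmapZ !mmapX /mmap1 !big_ord_recl !big_ord0 /=.
rewrite !mul_polyC derivZ !expr1n !mulr1 !mul1r /= derivXn.
congr (_ *: _).
rewrite (_ : lift ord0 ord0 = iy); last exact: val_inj.
by rewrite mnmBE mnm1E eqxx subn1 scaler_nat.
Qed.

(** The factors 1 and -1 put both half-planes in the form handled by
    [trajectory_near_sides]. *)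
Lemma half_planesE :
  (right_half_plane (R := R) = [set p | 0 < 1 * p.2]) *
  (left_half_plane (R := R) = [set p | 0 < -1 * p.2]).
Proof.
have chartK (p : R * R) : p.2 != 0 -> first_chart (p.2^-1, p.1 / p.2) = p.
  move: p => [xi th] /= th0; rewrite /first_chart /= invrK; congr (_, _); field.
  exact: th0.
split; apply/seteqP; split => [_ [q /= q1 <-]|p /=].
- by rewrite mul1r invr_gt0.
- rewrite mul1r => p0; exists (p.2^-1, p.1 / p.2); rewrite /= ?invr_gt0 //.
  by rewrite chartK // gt_eqF.
- by rewrite mulN1r oppr_gt0 invr_lt0.
- rewrite mulN1r oppr_gt0 => p0; exists (p.2^-1, p.1 / p.2).
    by rewrite /= invr_lt0.
  by rewrite chartK // lt_eqF.
Qed.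

Lemma continuous_poly_sum m (k : 'I_m -> nat) (q : 'I_m -> {poly R}) :
  continuous (fun p : R * R => \sum_(i < m) p.2 ^+ k i * (q i).[p.1]).
Proof.
move=> p; apply: (@cvg_big _ _ +%R); first exact: add_continuous.
move=> i _; apply: cvgM.
  have := @exprn_continuous R (k i) p.2.
  apply: continuous_comp; exact: cvg_snd.
apply: (@continuous_comp _ _ _ fst (horner (q i))); first exact: cvg_fst.
exact: continuous_horner.
Qed.

(** At theta = 0 only the terms of top degree of the two sums survive. *)
Lemma reduced_field_contact n (X Y : nat -> bipoly R) a :
  (0 < n)%N -> peval (X n) 1 a = 0 ->
  reduced_field n X Y (infinite_point a) = (peval (W X Y n.-1) 1 a, 0).
Proof.
case: n => // n _ Xa; rewrite /reduced_field /=; congr (_, _).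
  rewrite big_ord_recr /= subSn // subnn expr0 mul1r big1 ?add0r // => j _.
  by rewrite expr0n -subnDA addn1 subSS subn_eq0 leqNgt ltn_ord mul0r.
rewrite big_ord_recr /= subnn expr0 mul1r Xa addr0 big1 ?oppr0 // => j _.
by rewrite expr0n subn_eq0 leqNgt ltn_ord mul0r.
Qed.

(** In degree 0 the components are constants c and d, and x d - y c = 0 for
    all x, y forces both to vanish. *)
Lemma projectively_singular_degree n (X Y : nat -> bipoly R) :
  is_system n X Y -> projectively_singular n X Y -> (0 < n)%N.
Proof.
case: n => // -[hX hY top _] sing; case: top.
have const p : p \is ishomog1 0 (@mdeg 2) -> exists c : R, p = mpolyC 2 c.
  move=> /dhomogP hp; exists (mcoeff mnm0 p); apply: msize1_polyC.
  rewrite msizeE; apply/bigmax_leqP_seq => m /hp; rewrite /= => -> //.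
have [c Xc] := const _ (hX 0%N isT); have [d Yd] := const _ (hY 0%N isT).
have WE x y : peval (W X Y 0) x y = x * d - y * c.
  by rewrite /peval /W Xc Yd mevalB !mevalM !mevalXU !mevalC /=.
have := sing 1 0; have := sing 0 1; rewrite !WE Xc Yd.
rewrite !mul0r !mul1r sub0r subr0 => /eqP; rewrite oppr_eq0 => /eqP -> ->.
by rewrite mpolyC0.
Qed.

(** * Sign of a polynomial near a zero *)

(** Writing q = r (X - a) gives q'(a) = r(a), and r keeps its sign near [a]. *)
Lemma near_simple_root (q : {poly R}) a : q.[a] = 0 -> q^`().[a] != 0 ->
  \forall xi \near a, xi != a -> 0 < q^`().[a] * (q.[xi] * (xi - a)).
Proof.
move=> qa; have /factor_theorem[r ->] : root q a by apply/rootP.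
rewrite derivM derivXsubC mulr1 hornerD hornerM hornerXsubC subrr mulr0 add0r.
move=> r0.
have cr : r.[a] * r.[xi] @[xi --> a] --> r.[a] * r.[a].
  apply: cvgMr; exact: continuous_horner.
have : \forall xi \near a, 0 < r.[a] * r.[xi].
  by apply: cvgr_gt cr _ _; rewrite -expr2 exprn_even_gt0.
apply: filterS => xi rr xia; rewrite hornerM hornerXsubC.
rewrite -mulrA mulrA -expr2 pmulr_rgt0 //.
by rewrite exprn_even_gt0 // subr_eq0.
Qed.

(** Writing q = r (X - a) gives q''(a) = 2 r'(a), and [a] is a simple zero
    of r. *)
Lemma near_double_root (q : {poly R}) a :
  q.[a] = 0 -> q^`().[a] = 0 -> q^`()^`().[a] != 0 ->
  \forall xi \near a, xi != a -> 0 < q^`()^`().[a] * q.[xi].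
Proof.
move=> qa; have /factor_theorem[r ->] : root q a by apply/rootP.
rewrite derivM derivXsubC mulr1 hornerD hornerM hornerXsubC subrr mulr0 add0r.
move=> ra.
rewrite derivD derivM derivXsubC mulr1 !hornerD hornerM hornerXsubC subrr mulr0.
rewrite add0r -mulr2n => r'0.
have {}r'0 : r^`().[a] != 0 by apply: contra_neq r'0 => ->; rewrite mul0rn.
apply: filterS (near_simple_root ra r'0) => xi + xia => /(_ xia).
by rewrite hornerM hornerXsubC mulrnAl => ?; rewrite pmulrn_rgt0.
Qed.

(** * Trajectories near the contact point *)

(** The neighbourhood is chosen so that f keeps the sign of [w], h stays bounded
    and the sign conditions on X_n(1, xi) hold. *)
Lemma trajectory_near_sides n (X Y : nat -> bipoly R) a w (s1 s2 : R) :
  w = (reduced_field n X Y (infinite_point a)).1 -> w != 0 ->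
  (\forall xi \near a, 0 < - (w * (xi - a)) -> 0 < s1 * peval (X n) 1 xi) ->
  (\forall xi \near a, 0 < w * (xi - a) -> 0 < - (s2 * peval (X n) 1 xi)) ->
  trajectory_near n X Y (infinite_point a)
    [set p | 0 < s1 * p.2] [set p | 0 < s2 * p.2].
Proof.
move=> wE w0 before after; set A := infinite_point a.
pose f p := (reduced_field n X Y p).1.
pose h (p : R * R) := \sum_(i < n) p.2 ^+ (n - i - 1) * (dehom (X i)).[p.1].
have fE :
    f = fun p => \sum_(j < n) p.2 ^+ (n - j - 1) * (dehom (W X Y j)).[p.1].
  by apply/funext => p; apply: eq_bigr => j _; rewrite horner_dehom.
have thE p : (reduced_field n X Y p).2 = - peval (X n) 1 p.1 - p.2 * h p.
  rewrite /= big_ord_recr /= subnn expr0 mul1r opprD addrC; congr (_ - _).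
  rewrite mulr_sumr; apply: eq_bigr => i _; rewrite horner_dehom mulrA -exprS.
  by rewrite subn1 prednK // subn_gt0.
have f_near : \forall p \near A, 0 < w * f p.
  have cf : w * f p @[p --> A] --> w * f A.
    apply: cvgMr; rewrite fE; exact: continuous_poly_sum.
  by apply: cvgr_gt cf _ _; rewrite /f -wE -expr2 exprn_even_gt0.
have h_near : \forall p \near A, `|h p| <= `|h A| + 1.
  have ch : h p @[p --> A] --> h A by exact: continuous_poly_sum.
  by apply: cvgr_norm_le ch _ _; rewrite ltrDl.
have near_fst (Q : R -> Prop) :
    (\forall xi \near a, Q xi) -> \forall p \near A, Q p.1.
  by move=> Qa; apply: (@cvg_fst _ _ (nbhs a) (nbhs (0 : R)) _).
pose U := [set p | [/\ 0 < w * f p, `|h p| <= `|h A| + 1,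
   0 < - (w * (p.1 - a)) -> 0 < s1 * peval (X n) 1 p.1 &
   0 < w * (p.1 - a) -> 0 < - (s2 * peval (X n) 1 p.1)]].
exists U.
  near=> p; split.
  - by near: p; exact: f_near.
  - by near: p; exact: h_near.
  - by near: p; exact: near_fst before.
  - by near: p; exact: near_fst after.
move=> gamma alpha t0 beta [t0_in g0 arc].
have {}arc t : alpha < t < beta -> [/\ U (gamma t),
      is_derive t (1 : R) (fun u => (gamma u).1) (f (gamma t)) &
      is_derive t (1 : R) (fun u => (gamma u).2)
          (- peval (X n) 1 (gamma t).1 - (gamma t).2 * h (gamma t))].
  by move=> /arc[Ut d1]; rewrite thE.
split=> t /andP[t1 t2].
- apply: (side_of_arc (d := -1) _ _ t0_in g0 arc).
  + by rewrite mulrNN mulr1.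
  + move=> p [fp hp bp _]; split; [exact: fp | exact: hp |].
    by rewrite mulN1r => /bp; rewrite mulrN1 mulrNN.
  + by rewrite t1 /= (lt_trans t2) //; case/andP: t0_in.
  + by lra.
- apply: (side_of_arc (d := 1) _ _ t0_in g0 arc).
  + by rewrite mulr1.
  + move=> p [fp hp _ ap]; split; [exact: fp | exact: hp |].
    by rewrite mul1r => /ap; rewrite mulr1 mulrN.
  + by rewrite t2 andbT (lt_trans _ t1) //; case/andP: t0_in.
  + by lra.
Unshelve. all: by end_near. Qed.

End ProjectiveContact.

Theorem mainTheorem17 (R : realType) (n : nat) (X Y : nat -> bipoly R) (a : R) :
  is_system n X Y ->
  projectively_singular n X Y ->
  peval (X n) 1 a = 0 ->
  let A := infinite_point a in
  let w := peval (W X Y n.-1) 1 a in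
  let X_y := peval (partial_y (X n)) 1 a in
  let X_yy := peval (partial_y (partial_y (X n))) 1 a in
  [/\ w * X_y < 0 ->
        equatorial_contact_point n X Y A /\
        trajectory_near n X Y A (right_half_plane (R := R)) (right_half_plane (R := R)),
      0 < w * X_y ->
        equatorial_contact_point n X Y A /\
        trajectory_near n X Y A (left_half_plane (R := R)) (left_half_plane (R := R)) &
      X_y = 0 -> w * X_yy <> 0 ->
        equatorial_contact_point n X Y A /\
        (trajectory_near n X Y A (left_half_plane (R := R)) (right_half_plane (R := R)) \/
         trajectory_near n X Y A (right_half_plane (R := R)) (left_half_plane (R := R)))].
Proof.
move=> sys sing Xa A w X_y X_yy.
have n0 := projectively_singular_degree sys sing.
have fA : reduced_field n X Y A = (w, 0) by exact: reduced_field_contact.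
have wE : w = (reduced_field n X Y A).1 by rewrite fA.
have contact : w != 0 -> equatorial_contact_point n X Y A.
  by move=> /eqP w0; split; rewrite ?fA // => -[].
pose q := dehom (X n).
have qE x : q.[x] = peval (X n) 1 x by exact: horner_dehom.
have qa : q.[a] = 0 by rewrite qE.
have q'E : q^`().[a] = X_y by rewrite -dehom_partial_y horner_dehom.
have q''E : q^`()^`().[a] = X_yy by rewrite -!dehom_partial_y horner_dehom.
have side_neq x : 0 < - (w * (x - a)) \/ 0 < w * (x - a) -> x != a.
  by case=> h; apply/eqP => xa; move: h; rewrite xa subrr mulr0 ?oppr0 ltxx.
(* Simple zero: s * w * X_y < 0 makes both half-arcs go to the side s. *)
have fold s : s * (w * X_y) < 0 ->
    trajectory_near n X Y A [set p | 0 < s * p.2] [set p | 0 < s * p.2].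
  move=> swX.
  have [w0 X_y0 ] : w != 0 /\ X_y != 0.
    by split; apply/eqP => e0; move: swX; rewrite e0 ?mulr0 ?mul0r ?mulr0 ltxx.
  have q_near : \forall x \near a, x != a -> s * (w * (x - a)) * q.[x] < 0.
    have := near_simple_root qa; rewrite q'E => /(_ X_y0).
    apply: filterS => x + xa => /(_ xa) qx.
    have : (s * (w * X_y)) * (X_y * (q.[x] * (x - a))) < 0.
      by rewrite pmulr_llt0.
    rewrite (_ : _ * _ = X_y ^+ 2 * (s * (w * (x - a)) * q.[x])); last by ring.
    by rewrite pmulr_rlt0 // exprn_even_gt0.
  apply: (trajectory_near_sides wE w0); apply: filterS q_near => x qx side;
    rewrite -qE; have {}qx := qx (side_neq x _).
  - have := qx (or_introl side).
    rewrite (_ : _ * _ = - (w * (x - a)) * - (s * q.[x])); last by ring.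
    by rewrite pmulr_rlt0 // oppr_lt0.
  - have := qx (or_intror side).
    rewrite (_ : _ * _ = w * (x - a) * (s * q.[x])); last by ring.
    by rewrite pmulr_rlt0 // oppr_gt0.
(* Double zero: P keeps the sign of X_yy, so theta has that sign before A and
   the opposite one after. *)
have inflection s : X_y = 0 -> w != 0 -> 0 < s * X_yy ->
    trajectory_near n X Y A [set p | 0 < s * p.2] [set p | 0 < - s * p.2].
  move=> X_y0 w0 sX.
  have X_yy0 : X_yy != 0 by apply/eqP => e0; move: sX; rewrite e0 mulr0 ltxx.
  have q_near : \forall x \near a, x != a -> 0 < s * q.[x].
    have := near_double_root qa; rewrite q'E q''E => /(_ X_y0 X_yy0).
    apply: filterS => x + xa => /(_ xa) qx.
    have : 0 < (s * X_yy) * (X_yy * q.[x]) by rewrite mulr_gt0.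
    rewrite (_ : _ * _ = X_yy ^+ 2 * (s * q.[x])); last by ring.
    by rewrite pmulr_rgt0 // exprn_even_gt0.
  apply: (trajectory_near_sides wE w0); apply: filterS q_near => x qx side;
    rewrite -qE ?mulNr ?opprK; apply: qx; apply: side_neq; [by left | by right].
rewrite !half_planesE.
split.
- move=> wX; split; last by apply: fold; rewrite mul1r.
  by apply: contact; apply/eqP => w0; move: wX; rewrite w0 mul0r ltxx.
- move=> wX; split; last by apply: fold; rewrite mulN1r oppr_lt0.
  by apply: contact; apply/eqP => w0; move: wX; rewrite w0 mul0r ltxx.
- move=> X_y0 /eqP; rewrite mulf_eq0 negb_or => /andP[w0 X_yy0].
  split; first exact: contact.
  have [neg|pos|/eqP] := ltrgtP X_yy 0; last by rewrite (negbTE X_yy0).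
  + left; have := inflection (-1) X_y0 w0; rewrite opprK; apply.
    by rewrite mulN1r oppr_gt0.
  + by right; apply: inflection => //; rewrite mul1r.
Qed.
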